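(* Let $g \geq 2$ and let $\Gamma_g$ be the fundamental group of a closed orientable surface of genus $g$. There exists a residually nilpotent group $G$ of rank $2g$, not isomorphic to $\Gamma_g$, such that $G/\gamma_i(G) \cong \Gamma_g/\gamma_i(\Gamma_g)$ for all $i \geq 1$.
   Context: The lower central series of a group $G$ is $\gamma_1(G) = G$, $\gamma_k(G) = [G,\gamma_{k-1}(G)]$ for $k\ge 2$. The rank of a group is the minimal size of a generating set. A group is residually nilpotent if $\bigcap_i \gamma_i(G) = 1$. *)

(* Defs.v *)
From Stdlib Require Import List Arith.
Import ListNotations.
Set Implicit Arguments.

Record Group := {
  carrier :> Type;
  gmul : carrier -> carrier -> carrier;
  gone : carrier;
  ginv : carrier -> carrier;
  gmulA : forall x y z, gmul x (gmul y z) = gmul (gmul x y) z;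
  gmul1l : forall x, gmul gone x = x;
  gmul1r : forall x, gmul x gone = x;
  gmulVl : forall x, gmul (ginv x) x = gone;
  gmulVr : forall x, gmul x (ginv x) = gone
}.

Section GroupDefs.
Variable G : Group.

Definition comm (x y : G) : G :=
  gmul G (gmul G (ginv G x) (ginv G y)) (gmul G x y).

Inductive gen (S : G -> Prop) : G -> Prop :=
  | gen_base : forall x, S x -> gen S x
  | gen_one : gen S (gone G)
  | gen_mul : forall x y, gen S x -> gen S y -> gen S (gmul G x y)
  | gen_inv : forall x, gen S x -> gen S (ginv G x).

(** lower central series: gamma 1 = G, gamma (k+1) = [G, gamma k]
    (gamma 0 is set to G by convention and never used). *)
Fixpoint gamma (i : nat) : G -> Prop :=
  match i with
  | 0 | 1 => fun _ => True
  | S k => gen (fun z => exists x y, gamma k y /\ z = comm x y)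
  end.

Definition residually_nilpotent : Prop :=
  forall x : G, (forall i, 1 <= i -> gamma i x) -> x = gone G.

Definition generated_by (s : list G) : Prop :=
  forall x : G, gen (fun y => In y s) x.

Definition has_rank (n : nat) : Prop :=
  (exists s : list G, length s = n /\ generated_by s) /\
  (forall s : list G, generated_by s -> n <= length s).

Fixpoint prod_comm (a b : nat -> G) (k : nat) : G :=
  match k with
  | 0 => gone G
  | S k' => gmul G (prod_comm a b k') (comm (a k') (b k'))
  end.
End GroupDefs.

Definition is_hom (G H : Group) (f : G -> H) : Prop :=
  forall x y : G, f (gmul G x y) = gmul H (f x) (f y).

Definition isomorphic (G H : Group) : Prop :=
  exists f : G -> H, is_hom G H f /\
    (forall x y, f x = f y -> x = y) /\ (forall h, exists x, f x = h).

(** G/N is isomorphic to H/M (N, M normal subgroups), written out via a lift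
    f : G -> H of an isomorphism G/N -> H/M: f is a homomorphism modulo M,
    its kernel modulo M is exactly N, and it is surjective modulo M. *)
Definition quotient_isomorphic (G : Group) (N : G -> Prop)
    (H : Group) (M : H -> Prop) : Prop :=
  exists f : G -> H,
    (forall x y : G,
        M (gmul H (ginv H (f (gmul G x y))) (gmul H (f x) (f y)))) /\
    (forall x : G, M (f x) <-> N x) /\
    (forall h : H, exists x : G, M (gmul H (ginv H (f x)) h)).

(** Gam, with elements a 0..a (g-1), b 0..b (g-1), is the group with
    presentation < a_1,b_1,...,a_g,b_g | [a_1,b_1]...[a_g,b_g] = 1 >,
    i.e. the fundamental group of the closed orientable surface of genus g:
    the relation holds, the a_i, b_i generate, and every assignment in a
    group satisfying the relation extends to a homomorphism. *)
Definition is_surface_group (g : nat) (Gam : Group) (a b : nat -> Gam) : Prop :=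
  prod_comm Gam a b g = gone Gam /\
  (forall x : Gam, @gen Gam (fun y => exists i, i < g /\ (y = a i \/ y = b i)) x) /\
  (forall (H : Group) (c d : nat -> H), prod_comm H c d g = gone H ->
     exists f : Gam -> H, is_hom Gam H f /\
       forall i, i < g -> f (a i) = c i /\ f (b i) = d i).

(* Main.v *)
(** [G] is the largest residually nilpotent group on [a i], [b i] satisfying the
    surface relation with [a 0] replaced by [a 0 [a 1, a 0]]. In a nilpotent group the
    equation [x [y, x] = c] has exactly one solution [x], so modulo each term of the lower
    central series this replacement is a change of generators, and the quotients are
    those of the surface group.

    [G] is not a surface group because a degree is violated. It maps to the infinite
    dihedral group, hence acts transitively on Z/3, and all the twisted generators
    [a 0 [a 1, a 0]], [a 1], ..., [b i] fix the point 0. If [G] were a surface group,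
    every cup product of two classes in H^1(G; Z/3) would vanish on the stabiliser of 0,
    a subgroup of index 3. But the twisted generators satisfy the surface relation, and
    on this relation the cup product of the classes dual to [a 0] and [b 0] is 1. *)

Require Import Defs.
From Stdlib Require Import List Arith.
From Stdlib Require Import Lia ZArith Bool Ring.
From Stdlib Require Import FunctionalExtensionality PropExtensionality ProofIrrelevance.
From Stdlib Require Import ClassicalEpsilon.
From Stdlib Require FinFun.
Import ListNotations.

Declare Scope grp_scope.
Delimit Scope grp_scope with grp.
Infix "**" := (gmul _) (at level 40, left associativity) : grp_scope.
Notation "x ^-1" := (ginv _ x) (at level 3, left associativity, format "x ^-1") : grp_scope.
Notation "[~ x , y ]" := (comm _ x y) (at level 0, format "[~  x ,  y ]") : grp_scope.
Local Open Scope grp_scope.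

(** * Groups and homomorphisms *)

Lemma mulKg (G : Group) (x y : G) : x^-1 ** (x ** y) = y.
Proof. now rewrite gmulA, gmulVl, gmul1l. Qed.

Lemma mulVKg (G : Group) (x y : G) : x ** (x^-1 ** y) = y.
Proof. now rewrite gmulA, gmulVr, gmul1l. Qed.

Lemma mulgI (G : Group) (x y z : G) : x ** y = x ** z -> y = z.
Proof. intros E. now rewrite <- (mulKg G x y), E, mulKg. Qed.

Lemma invMg (G : Group) (x y : G) : (x ** y)^-1 = y^-1 ** x^-1.
Proof.
  apply (mulgI G (x ** y)). rewrite gmulVr, <- gmulA, mulVKg. now rewrite gmulVr.
Qed.

Lemma inv1g (G : Group) : (gone G)^-1 = gone G.
Proof. now rewrite <- (gmul1l G (gone G)^-1), gmulVr. Qed.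

Lemma invgK (G : Group) (x : G) : x^-1^-1 = x.
Proof. apply (mulgI G x^-1). now rewrite gmulVr, gmulVl. Qed.

Lemma mulV_eq1 (G : Group) (x y : G) : x^-1 ** y = gone G <-> x = y.
Proof.
  split; [intros E | intros ->; apply gmulVl].
  apply (mulgI G x^-1). now rewrite E, gmulVl.
Qed.

Global Hint Rewrite mulKg mulVKg invMg inv1g invgK gmul1l gmul1r gmulVl gmulVr : grp.
Global Hint Rewrite <- gmulA : grp.
Ltac group := unfold comm; autorewrite with grp; try reflexivity.

Lemma hom1 (G H : Group) (f : G -> H) : is_hom G H f -> f (gone G) = gone H.
Proof.
  intros hf. apply (mulgI H (f (gone G))). now rewrite <- hf, !gmul1r.
Qed.

Lemma homV (G H : Group) (f : G -> H) : is_hom G H f -> forall x, f x^-1 = (f x)^-1.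
Proof.
  intros hf x. apply (mulgI H (f x)). rewrite <- hf, !gmulVr. now apply hom1.
Qed.

Lemma hom_comm (G H : Group) (f : G -> H) :
  is_hom G H f -> forall x y, f [~ x, y] = [~ f x, f y].
Proof. intros hf x y. unfold comm. now rewrite !hf, !(homV G H f hf). Qed.

Lemma hom_comp (G H K : Group) (f : G -> H) (h : H -> K) :
  is_hom G H f -> is_hom H K h -> is_hom G K (fun x => h (f x)).
Proof. intros hf hh x y. now rewrite hf, hh. Qed.

Lemma hom_gen_eq (G H : Group) (S : G -> Prop) (f h : G -> H) :
  is_hom G H f -> is_hom G H h -> (forall x, S x -> f x = h x) ->
  forall x, gen G S x -> f x = h x.
Proof.
  intros hf hh E x. induction 1 as [x Sx| |x y _ IHx _ IHy|x _ IHx].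
  - now apply E.
  - now rewrite !hom1.
  - now rewrite hf, hh, IHx, IHy.
  - now rewrite !homV, IHx.
Qed.

Lemma gen_image (G H : Group) (f : G -> H) (S : G -> Prop) (T : H -> Prop) :
  is_hom G H f -> (forall x, S x -> gen H T (f x)) -> forall x, gen G S x -> gen H T (f x).
Proof.
  intros hf E x. induction 1 as [x Sx| |x y _ IHx _ IHy|x _ IHx].
  - now apply E.
  - rewrite hom1 by easy. apply gen_one.
  - rewrite hf. now apply gen_mul.
  - rewrite homV by easy. now apply gen_inv.
Qed.

Lemma gen_mono (G : Group) (S T : G -> Prop) :
  (forall x, S x -> T x) -> forall x, gen G S x -> gen G T x.
Proof.
  intros E x. apply (gen_image G G (fun x => x)); [now intros ? ?|].
  intros y Sy. apply gen_base. auto.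
Qed.

Definition surjective {A B : Type} (f : A -> B) : Prop := forall y, exists x, f x = y.

Lemma surjective_section (A B : Type) (f : A -> B) :
  surjective f -> exists s : B -> A, forall y, f (s y) = y.
Proof.
  intros sf.
  exists (fun y => proj1_sig (constructive_indefinite_description _ (sf y))).
  intros y. now destruct (constructive_indefinite_description _ (sf y)).
Qed.

(** * The lower central series *)

Lemma gammaS (G : Group) (i : nat) : 1 <= i ->
  gamma G (S i) = gen G (fun z => exists x y, gamma G i y /\ z = [~ x, y]).
Proof. destruct i; [lia|reflexivity]. Qed.

Lemma gamma1 (G : Group) (i : nat) : gamma G i (gone G).
Proof. destruct i as [|[|i]]; [exact I..|apply gen_one]. Qed.

Lemma gammaM (G : Group) (i : nat) (x y : G) : gamma G i x -> gamma G i y -> gamma G i (x ** y).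
Proof. destruct i as [|[|i]]; [easy..|apply gen_mul]. Qed.

Lemma gammaV (G : Group) (i : nat) (x : G) : gamma G i x -> gamma G i x^-1.
Proof. destruct i as [|[|i]]; [easy..|apply gen_inv]. Qed.

Lemma gamma_comm (G : Group) (i : nat) (x y : G) :
  1 <= i -> gamma G i y -> gamma G (S i) [~ x, y].
Proof. intros hi hy. rewrite gammaS by easy. apply gen_base. now exists x, y. Qed.

Lemma hom_gamma (G H : Group) (f : G -> H) (i : nat) :
  is_hom G H f -> forall x, gamma G i x -> gamma H i (f x).
Proof.
  intros hf. induction i as [|[|i] IH]; try easy.
  apply gen_image; [easy|]. intros z (x & y & hy & ->). rewrite hom_comm by easy.
  apply gen_base. exists (f x), (f y). split; [now apply IH|reflexivity].
Qed.

Lemma surjective_hom_gamma (G H : Group) (f : G -> H) (i : nat) :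
  is_hom G H f -> surjective f -> forall y, gamma H i y -> exists x, gamma G i x /\ f x = y.
Proof.
  intros hf sf. induction i as [|[|i] IH].
  1, 2: intros y _; destruct (sf y) as [x <-]; now exists x.
  intros y. induction 1 as [z (y & y' & hy' & ->)| |y y' _ IHy _ IHy'|y _ IHy].
  - destruct (sf y) as [x <-]. destruct (IH y' hy') as (x' & hx' & <-).
    exists [~ x, x']. split; [|now apply hom_comm]. apply gamma_comm; [lia|easy].
  - exists (gone G). split; [apply gamma1|now apply hom1].
  - destruct IHy as (x & hx & <-), IHy' as (x' & hx' & <-).
    exists (x ** x'). split; [now apply gammaM|apply hf].
  - destruct IHy as (x & hx & <-). exists x^-1. split; [now apply gammaV|now apply homV].
Qed.

Lemma gamma_descending (G : Group) (i : nat) (x : G) : gamma G (S i) x -> gamma G i x.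
Proof.
  revert x. induction i as [|[|i] IH]; try easy.
  apply gen_mono. intros z (x & y & hy & ->). exists x, y. split; [now apply IH|reflexivity].
Qed.

(** The conjugate is [x] times the inverse of [[~ y, x]], and this commutator lies one step further
    down the series. *)
Lemma gamma_conj (G : Group) (i : nat) (x y : G) : gamma G i x -> gamma G i (y^-1 ** x ** y).
Proof.
  intros hx. destruct i as [|i]; [easy|].
  replace (y^-1 ** x ** y) with (x ** [~ y, x]^-1^-1^-1) by group.
  destruct i as [|i]; [easy|]. apply gammaM; [easy|]. do 3 apply gammaV.
  apply gamma_descending, gamma_comm; [lia|easy].
Qed.

Lemma nilpotent_residually_nilpotent (G : Group) (i : nat) :
  1 <= i -> (forall x, gamma G i x -> x = gone G) -> residually_nilpotent G.
Proof. intros hi h x hx. auto. Qed.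

Lemma commutative_residually_nilpotent (G : Group) :
  (forall x y : G, x ** y = y ** x) -> residually_nilpotent G.
Proof.
  intros C. apply (nilpotent_residually_nilpotent G 2); [lia|].
  intros x. induction 1 as [z (x & y & _ & ->)| |x y _ -> _ ->|x _ ->]; group.
  now rewrite (C x y), mulKg, gmulVl.
Qed.

(** * Quotients *)

(** The group laws hold only up to [R]. Related elements have equal predicates [R x], so choice
    picks one representative per class; the carrier consists of these representatives. *)
Lemma quotient_structure (T : Type) (mul : T -> T -> T) (one : T) (inv : T -> T)
    (R : T -> T -> Prop) :
  (forall x, R x x) -> (forall x y, R x y -> R y x) ->
  (forall x y z, R x y -> R y z -> R x z) ->
  (forall x x' y y', R x x' -> R y y' -> R (mul x y) (mul x' y')) ->
  (forall x x', R x x' -> R (inv x) (inv x')) ->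
  (forall x y z, R (mul x (mul y z)) (mul (mul x y) z)) ->
  (forall x, R (mul one x) x) -> (forall x, R (mul x one) x) ->
  (forall x, R (mul (inv x) x) one) -> (forall x, R (mul x (inv x)) one) ->
  exists (Q : Group) (cls : T -> Q),
    (forall x y, cls (mul x y) = cls x ** cls y) /\
    (forall x y, cls x = cls y <-> R x y) /\ surjective cls.
Proof.
  intros Rr Rs Rt RM RV RA R1l R1r RVl RVr.
  set (rep := fun x => epsilon (inhabits one) (R x)).
  assert (R_rep : forall x, R x (rep x)).
  { intros x. apply (epsilon_spec (inhabits one) (R x)). now exists x. }
  assert (rep_eq : forall x y, R x y -> rep x = rep y).
  { intros x y Rxy. unfold rep. f_equal. apply functional_extensionality. intros z.
    apply propositional_extensionality. split; eauto. }
  set (Q := {x : T | rep x = x}).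
  set (cls := fun x => exist _ (rep x) (rep_eq _ _ (Rs _ _ (R_rep x))) : Q).
  assert (cls_eq : forall x y, R x y -> cls x = cls y).
  { intros x y Rxy. apply subset_eq_compat. auto. }
  assert (cls_val : forall q : Q, cls (proj1_sig q) = q).
  { intros [x hx]. apply subset_eq_compat. exact hx. }
  assert (R_val : forall x, R (proj1_sig (cls x)) x) by (intros x; apply Rs, R_rep).
  unshelve eexists
    {| carrier := Q;
       gmul := fun p q => cls (mul (proj1_sig p) (proj1_sig q));
       gone := cls one;
       ginv := fun p => cls (inv (proj1_sig p)) |}.
  - intros p q r. apply cls_eq. eapply Rt; [apply RM; [apply Rr|apply R_val]|].
    eapply Rt; [apply RA|]. apply RM; [apply Rs, R_val|apply Rr].
  - intros p. rewrite <- (cls_val p) at 2. apply cls_eq.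
    eapply Rt; [apply RM; [apply R_val|apply Rr]|apply R1l].
  - intros p. rewrite <- (cls_val p) at 2. apply cls_eq.
    eapply Rt; [apply RM; [apply Rr|apply R_val]|apply R1r].
  - intros p. apply cls_eq. eapply Rt; [apply RM; [apply R_val|apply Rr]|apply RVl].
  - intros p. apply cls_eq. eapply Rt; [apply RM; [apply Rr|apply R_val]|apply RVr].
  - exists cls. cbn. split; [|split].
    + intros x y. apply cls_eq. apply RM; apply Rs, R_val.
    + intros x y. split; [|apply cls_eq]. intros E. apply (f_equal (@proj1_sig _ _)) in E.
      cbn in E. apply (Rt _ (rep x)); [apply R_rep|rewrite E; apply Rs, R_rep].
    + intros q. exists (proj1_sig q). apply cls_val.
Qed.

Lemma normal_quotient (G : Group) (N : G -> Prop) :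
  N (gone G) -> (forall x y, N x -> N y -> N (x ** y)) -> (forall x, N x -> N x^-1) ->
  (forall x y, N x -> N (y^-1 ** x ** y)) ->
  exists (Q : Group) (cls : G -> Q),
    is_hom G Q cls /\ surjective cls /\ forall x, cls x = gone Q <-> N x.
Proof.
  intros N1 NM NV NJ.
  destruct (quotient_structure G (gmul G) (gone G) (ginv G) (fun x y => N (x^-1 ** y)))
    as (Q & cls & hM & hE & hS).
  - intros x. now rewrite gmulVl.
  - intros x y h. apply NV in h. revert h. now group.
  - intros x y z h h'. specialize (NM _ _ h h'). revert NM. now group.
  - intros x x' y y' h h'. replace ((x ** y)^-1 ** (x' ** y'))
      with ((y^-1 ** (x^-1 ** x') ** y) ** (y^-1 ** y')) by group. auto.
  - intros x x' h. replace (x^-1^-1 ** x'^-1)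
      with (x^-1^-1 ** (x^-1 ** x')^-1 ** x^-1) by group. auto.
  - intros x y z. now group.
  - intros x. now group.
  - intros x. now group.
  - intros x. now group.
  - intros x. now group.
  - exists Q, cls. split; [exact hM|split; [exact hS|]]. intros x.
    rewrite <- (hom1 G Q cls) by exact hM. split; intros E.
    + symmetry in E. apply hE in E. revert E. now group.
    + symmetry. apply hE. now group.
Qed.

Lemma gamma_quotient (G : Group) (i : nat) :
  exists (Q : Group) (cls : G -> Q),
    is_hom G Q cls /\ surjective cls /\ (forall x, cls x = gone Q <-> gamma G i x) /\
    (forall q, gamma Q i q -> q = gone Q).
Proof.
  destruct (normal_quotient G (gamma G i)) as (Q & cls & hM & hS & hK).
  - apply gamma1.
  - apply gammaM.
  - apply gammaV.
  - intros x y. apply gamma_conj.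
  - exists Q, cls. repeat split; try apply hK; auto.
    intros q hq. destruct (surjective_hom_gamma G Q cls i hM hS q hq) as (x & hx & <-).
    now apply hK.
Qed.

Lemma hom_factor (G Q H : Group) (cls : G -> Q) (f : G -> H) :
  is_hom G Q cls -> surjective cls -> is_hom G H f ->
  (forall x, cls x = gone Q -> f x = gone H) ->
  exists h : Q -> H, is_hom Q H h /\ forall x, h (cls x) = f x.
Proof.
  intros hc sc hf hk. destruct (surjective_section _ _ cls sc) as [s hs].
  assert (E : forall x y, cls x = cls y -> f x = f y).
  { intros x y e. apply mulV_eq1. rewrite <- homV, <- hf by easy. apply hk.
    rewrite hc, homV, e by easy. apply gmulVl. }
  exists (fun q => f (s q)). split.
  - intros p q. rewrite <- hf. apply E. now rewrite hc, !hs.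
  - intros x. apply E. apply hs.
Qed.

(** * Generators and relations in a class of groups *)

Inductive term (I : Type) : Type :=
  | tvar (i : I) | tone | tmul (s t : term I) | tinv (t : term I).

Fixpoint eval {I : Type} (H : Group) (v : I -> H) (t : term I) : H :=
  match t with
  | tvar _ i => v i
  | tone _ => gone H
  | tmul _ s t => eval H v s ** eval H v t
  | tinv _ t => (eval H v t)^-1
  end.

(** Terms are identified when they agree under every assignment satisfying [P]. By the last clause
    such assignments detect every non-trivial element, so residual properties pass to [G], although
    [P] is not claimed for [v0] itself. *)
Lemma universal_group (I : Type) (P : forall H : Group, (I -> H) -> Prop) :
  exists (G : Group) (v0 : I -> G),
    (forall x, gen G (fun y => exists i, y = v0 i) x) /\
    (forall (H : Group) (v : I -> H), P H v ->
       exists f, is_hom G H f /\ forall i, f (v0 i) = v i) /\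
    (forall x, (forall (H : Group) (v : I -> H) f, P H v -> is_hom G H f ->
       (forall i, f (v0 i) = v i) -> f x = gone H) -> x = gone G).
Proof.
  destruct (quotient_structure (term I) (@tmul I) (tone I) (@tinv I)
    (fun s t => forall H v, P H v -> eval H v s = eval H v t)) as (G & cls & hM & hE & hS).
  all: cbn; intros; auto using gmulA, gmul1l, gmul1r, gmulVl, gmulVr.
  - symmetry. auto.
  - transitivity (eval H1 v y); auto.
  - f_equal; auto.
  - f_equal; auto.
  - assert (h1 : cls (tone I) = gone G).
    { apply (mulgI G (cls (tone I))). rewrite <- hM, gmul1r. apply hE. cbn. intros.
      apply gmul1r. }
    assert (hV : forall t, cls (tinv I t) = (cls t)^-1).
    { intros t. apply (mulgI G (cls t)). rewrite <- hM, gmulVr, <- h1. apply hE. cbn. intros.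
      apply gmulVr. }
    assert (hf : forall H v, P H v -> exists f, is_hom G H f /\ forall t, f (cls t) = eval H v t).
    { intros H v Pv. destruct (surjective_section _ _ cls hS) as [s hs].
      exists (fun x => eval H v (s x)).
      assert (E : forall t, eval H v (s (cls t)) = eval H v t).
      { intros t. assert (e := hs (cls t)). now apply hE with (v := v) in e. }
      split; [|exact E]. intros x y. rewrite <- (hs x), <- (hs y), <- hM, !E. reflexivity. }
    exists G, (fun i => cls (tvar I i)). split; [|split].
    + intros x. destruct (hS x) as [t <-]. induction t as [i| |s IHs t IHt|t IHt].
      * apply gen_base. now exists i.
      * rewrite h1. apply gen_one.
      * rewrite hM. now apply gen_mul.
      * rewrite hV. now apply gen_inv.
    + intros H v Pv. destruct (hf H v Pv) as (f & hom & hev). exists f.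
      split; [exact hom|]. intros i. apply hev.
    + intros x hx. destruct (hS x) as [t <-]. rewrite <- h1. apply hE. intros H v Pv.
      destruct (hf H v Pv) as (f & hom & hev). rewrite <- hev. cbn.
      apply (hx H v f Pv hom). intros i. apply hev.
Qed.

(** * The twisted surface group *)

(** The endomorphism of the free group fixing every generator but the first. In a
    nilpotent group it is bijective on tuples, but in the infinite dihedral group
    it sends a rotation and a reflection [a 0, a 1] to [(a 0)^3, a 1]. *)
Definition twist (G : Group) (a : nat -> G) (i : nat) : G :=
  match i with
  | 0 => a 0 ** [~ a 1, a 0]
  | S _ => a i
  end.

Lemma prod_comm_ext (G : Group) (a b a' b' : nat -> G) (k : nat) :
  (forall i, i < k -> a i = a' i /\ b i = b' i) -> prod_comm G a b k = prod_comm G a' b' k.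
Proof.
  induction k as [|k IH]; intros E; cbn; [reflexivity|].
  destruct (E k) as [-> ->]; [lia|]. rewrite IH; auto.
Qed.

Lemma hom_prod_comm (G H : Group) (f : G -> H) (a b : nat -> G) (k : nat) :
  is_hom G H f -> f (prod_comm G a b k) = prod_comm H (fun i => f (a i)) (fun i => f (b i)) k.
Proof.
  intros hf. induction k as [|k IH]; cbn; [now apply hom1|].
  now rewrite hf, hom_comm, IH.
Qed.

Lemma prod_comm_commutative (G : Group) (a b : nat -> G) (k : nat) :
  (forall x y : G, x ** y = y ** x) -> prod_comm G a b k = gone G.
Proof.
  intros C. induction k as [|k IH]; cbn; [reflexivity|].
  rewrite IH. unfold comm. rewrite (C (a k) (b k)). group.
Qed.

Lemma prod_comm_one (G : Group) (a : nat -> G) (k : nat) :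
  prod_comm G a (fun _ => gone G) k = gone G.
Proof. induction k as [|k IH]; cbn; [reflexivity|]. rewrite IH. group. Qed.

Lemma hom_twist (G H : Group) (f : G -> H) (a : nat -> G) (i : nat) :
  is_hom G H f -> f (twist G a i) = twist H (fun j => f (a j)) i.
Proof. intros hf. destruct i; cbn; [|reflexivity]. now rewrite hf, hom_comm. Qed.

Lemma twist_ext (G : Group) (g : nat) (a a' : nat -> G) (i : nat) :
  2 <= g -> (forall j, j < g -> a j = a' j) -> i < g -> twist G a i = twist G a' i.
Proof.
  intros hg E hi. destruct i; cbn; [|now apply E]. now rewrite !E by lia.
Qed.

Definition twisted_relation (g : nat) (G : Group) (a b : nat -> G) : Prop :=
  prod_comm G (twist G a) b g = gone G.

(** The Boolean index separates the [a i] from the [b i], and values from index [g] on are forced to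
    be trivial. Homomorphisms preserve the lower central series, so an element in all its terms dies
    in every residually nilpotent target and is therefore trivial in [G]. *)
Lemma twisted_group (g : nat) : 2 <= g ->
  exists (G : Group) (a b : nat -> G),
    residually_nilpotent G /\ twisted_relation g G a b /\
    (forall x, gen G (fun y => exists i, i < g /\ (y = a i \/ y = b i)) x) /\
    (forall (H : Group) (c d : nat -> H), residually_nilpotent H -> twisted_relation g H c d ->
       exists f, is_hom G H f /\ forall i, i < g -> f (a i) = c i /\ f (b i) = d i).
Proof.
  intros hg.
  destruct (universal_group (bool * nat) (fun H v =>
      residually_nilpotent H /\ (forall e i, g <= i -> v (e, i) = gone H) /\
      twisted_relation g H (fun i => v (false, i)) (fun i => v (true, i))))
    as (G & v0 & hG & hU & h1).
  exists G, (fun i => v0 (false, i)), (fun i => v0 (true, i)). repeat split.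
  - intros x hx. apply h1. intros H v f (hR & _ & _) hf _. apply hR.
    intros i hi. apply hom_gamma; auto.
  - apply h1. intros H v f (_ & _ & hr) hf hv. rewrite <- hr, (hom_prod_comm _ _ _ _ _ _ hf).
    apply prod_comm_ext. intros i hi. rewrite hom_twist by easy. split; [|apply hv].
    apply (twist_ext _ g); auto.
  - intros x. specialize (hG x).
    induction hG as [y [[e i] ->]| |y z _ IHy _ IHz|y _ IHy]; [|now constructor..].
    destruct (Nat.lt_ge_cases i g) as [hi|hi].
    + apply gen_base. exists i. destruct e; auto.
    + replace (v0 (e, i)) with (gone G); [apply gen_one|].
      symmetry. apply h1. intros H v f (_ & hv & _) _ E. rewrite E. now apply hv.
  - intros H c d hR hr.
    set (v := fun p : bool * nat => if snd p <? g then if fst p then d (snd p) else c (snd p)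
                                    else gone H).
    assert (hv : forall i, i < g -> v (false, i) = c i /\ v (true, i) = d i).
    { intros i hi. unfold v. cbn [fst snd]. now rewrite (proj2 (Nat.ltb_lt i g)). }
    destruct (hU H v) as (f & hf & E).
    + split; [exact hR|split].
      * intros e i hi. unfold v. cbn [fst snd]. now rewrite (proj2 (Nat.ltb_ge i g)).
      * transitivity (prod_comm H (twist H c) d g); [|exact hr].
        apply prod_comm_ext. intros i hi. split; [|now apply hv].
        apply (twist_ext _ g); try easy. intros j hj. now apply hv.
    + exists f. split; [exact hf|]. intros i hi. rewrite !E. now apply hv.
Qed.

(** Induction on the class. The term [gamma K i] is central, so multiplying [x] by one of its
    elements [z] multiplies [x ** [~ y, x]] by [z]. The map is thus a translation along each fibre
    over [Q], and it is bijective on [Q] by induction. *)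
Lemma nilpotent_twist_bijective (i : nat) : 1 <= i ->
  forall K : Group, (forall x, gamma K i x -> x = gone K) -> forall y c : K,
  (exists x, x ** [~ y, x] = c) /\
  (forall x x', x ** [~ y, x] = x' ** [~ y, x'] -> x = x').
Proof.
  induction 1 as [|i hi IH]; intros K hK y c.
  - assert (hK' : forall x, x = gone K) by (intros x; now apply hK).
    split; [exists c|intros x x' _]; (transitivity (gone K); [|symmetry]; apply hK').
  - destruct (gamma_quotient K i) as (Q & cls & hc & sc & kc & hQ).
    assert (Z : forall x z, gamma K i z -> x ** z = z ** x).
    { intros x z hz. assert (e : [~ x, z] = gone K) by (now apply hK, gamma_comm).
      apply (mulgI K (z ** x)^-1). rewrite gmulVl, <- e. group. }
    assert (E : forall x z, gamma K i z -> (x ** z) ** [~ y, x ** z] = x ** [~ y, x] ** z).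
    { intros x z hz. rewrite <- gmulA, <- (Z _ z hz), gmulA. f_equal. f_equal.
      rewrite (Z x z hz). transitivity (y^-1 ** x^-1 ** (z^-1 ** (y ** z)) ** x); [group|].
      rewrite (Z y z hz). group. }
    destruct (IH Q hQ (cls y) (cls c)) as [[xi hxi] uni]. split.
    + destruct (sc xi) as [x <-]. set (z := (x ** [~ y, x])^-1 ** c).
      assert (hz : gamma K i z).
      { apply kc. unfold z. rewrite hc, homV, hc, hom_comm, hxi by easy. apply gmulVl. }
      exists (x ** z). rewrite E by easy. apply mulVKg.
    + intros x x' e. set (z := x^-1 ** x').
      assert (hz : gamma K i z).
      { apply kc. unfold z. rewrite hc, homV by easy. apply mulV_eq1, uni.
        now rewrite <- !hom_comm, <- !hc, e by easy. }
      assert (ex : x' = x ** z) by (unfold z; now rewrite mulVKg).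
      rewrite ex, E in e by easy. rewrite ex.
      replace z with (gone K); [now rewrite gmul1r|].
      apply (mulgI K (x ** [~ y, x])). rewrite <- e. apply gmul1r.
Qed.

(** Solving the twist equation in [Q] gives [F] from [G] to [Q]; sending the surface generators to
    the twisted ones gives [P] from [Q] to [R]. Then [P] after [F] is the projection [r], which
    bounds the kernel of [F] by [gamma G i]. *)
Lemma twisted_quotient_isomorphic (g : nat) (Gam : Group) (a b : nat -> Gam)
    (G : Group) (a' b' : nat -> G) :
  2 <= g -> is_surface_group g Gam a b -> twisted_relation g G a' b' ->
  (forall x, gen G (fun y => exists i, i < g /\ (y = a' i \/ y = b' i)) x) ->
  (forall (H : Group) (c d : nat -> H), residually_nilpotent H -> twisted_relation g H c d ->
     exists f, is_hom G H f /\ forall i, i < g -> f (a' i) = c i /\ f (b' i) = d i) ->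
  forall i, 1 <= i -> quotient_isomorphic G (gamma G i) Gam (gamma Gam i).
Proof.
  intros hg (rGam & genGam & uGam) rG genG uG i hi.
  destruct (gamma_quotient Gam i) as (Q & q & hq & sq & kq & nQ).
  destruct (gamma_quotient G i) as (R & r & hr & sr & kr & nR).
  destruct (nilpotent_twist_bijective i hi Q nQ (q (a 1)) (q (a 0))) as [[xi hxi] _].
  set (c := fun j => match j with 0 => xi | S _ => q (a j) end).
  assert (tc : forall j, twist Q c j = q (a j)) by (now intros [|j]).
  destruct (uG Q c (fun j => q (b j))) as (F & hF & EF).
  { now apply (nilpotent_residually_nilpotent Q i). }
  { transitivity (q (prod_comm Gam a b g)).
    - rewrite (hom_prod_comm _ _ _ _ _ _ hq). apply prod_comm_ext. auto.
    - rewrite rGam. now apply hom1. }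
  assert (sF : surjective F).
  { intros y. destruct (sq y) as [x <-]. specialize (genGam x).
    induction genGam as [x (j & hj & [-> | ->])| |x x' _ [u hu] _ [u' hu']|x _ [u hu]].
    - exists (twist G a' j). rewrite hom_twist, <- tc by easy.
      apply (twist_ext _ g); auto. intros j' hj'. now apply EF.
    - exists (b' j). now apply EF.
    - exists (gone G). now rewrite !hom1.
    - exists (u ** u'). now rewrite hF, hq, hu, hu'.
    - exists u^-1. now rewrite !homV, hu. }
  destruct (uGam G (twist G a') b' rG) as (f0 & hf0 & Ef0).
  destruct (hom_factor Gam Q R q (fun x => r (f0 x))) as (P & hP & EP); try easy.
  { now apply (hom_comp Gam G R). }
  { intros x hx. apply kr. apply hom_gamma; [easy|]. now apply kq. }
  assert (EPF : forall x, P (F x) = r x).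
  { intros x. apply (hom_gen_eq G R _ (fun x => P (F x)) r) with (4 := genG x); [|easy|].
    { now apply (hom_comp G Q R). }
    intros y (j & hj & [-> | ->]); destruct (EF j hj) as [EA EB], (Ef0 j hj) as [eA eB].
    - rewrite EA. destruct j as [|j]; [|cbn; now rewrite EP, eA].
      (* [P xi] and [r (a' 0)] solve the same twist equation in [R], so uniqueness identifies them;
         [gone R] is a placeholder right-hand side. *)
      destruct (nilpotent_twist_bijective i hi R nR (r (a' 1)) (gone R)) as [_ uni].
      apply uni. cbn in *. destruct (Ef0 1) as [e1 _]; [lia|]. cbn in e1.
      transitivity (r (f0 (a 0))); [|rewrite eA, hr, (hom_comm G R r hr); reflexivity].
      now rewrite <- e1, <- !EP, <- hxi, hP, (hom_comm Q R P hP).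
    - now rewrite EB, EP, eB. }
  destruct (surjective_section _ _ q sq) as [s hs].
  exists (fun x => s (F x)). split; [|split].
  - intros x y. apply kq. rewrite hq, homV, hq, !hs by easy. apply mulV_eq1, hF.
  - intros x. rewrite <- kq, hs. split; intros hx.
    + apply kr. now rewrite <- EPF, hx, hom1.
    + apply nQ. now apply hom_gamma.
  - intros h. destruct (sF (q h)) as [x hx]. exists x.
    apply kq. rewrite hq, homV, hs by easy. now apply mulV_eq1.
Qed.

(** * Rank *)

(** Infinite sequences over the field with two elements, so that no dimension enters the type;
    [Nat.eqb j] is the basis vector number [j]. *)
Definition bool_seq_group : Group.
Proof.
  refine {| carrier := nat -> bool; gmul := fun u v n => xorb (u n) (v n);
            gone := fun _ => false; ginv := fun u => u |};
    intros; apply functional_extensionality; intros n.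
  - symmetry. apply xorb_assoc.
  - apply xorb_false_l.
  - apply xorb_false_r.
  - apply xorb_nilpotent.
  - apply xorb_nilpotent.
Defined.

Lemma bool_seq_commutative (u v : bool_seq_group) : u ** v = v ** u.
Proof. apply functional_extensionality. intros n. apply xorb_comm. Qed.

(** In a commutative group of exponent two each generator is needed at most once, so this lists the
    whole subgroup generated by [l]. *)
Fixpoint subset_sums (l : list bool_seq_group) : list bool_seq_group :=
  match l with
  | [] => [gone _]
  | u :: l => subset_sums l ++ map (gmul _ u) (subset_sums l)
  end.

Lemma subset_sums_length (l : list bool_seq_group) : length (subset_sums l) = 2 ^ length l.
Proof.
  induction l as [|u l IH]; cbn [subset_sums length Nat.pow]; [reflexivity|].
  rewrite length_app, length_map, IH. lia.
Qed.

Lemma subset_sums_one (l : list bool_seq_group) : In (gone _) (subset_sums l).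
Proof. induction l; cbn [subset_sums]; [now left|]. apply in_or_app. now left. Qed.

Lemma subset_sums_mul (l : list bool_seq_group) (u v : bool_seq_group) :
  In u (subset_sums l) -> In v (subset_sums l) -> In (u ** v) (subset_sums l).
Proof.
  revert u v. induction l as [|w l IH]; cbn [subset_sums]; intros u v.
  - intros [<-|[]] [<-|[]]. left. symmetry. apply gmul1l.
  - rewrite !in_app_iff, !in_map_iff.
    intros [hu|(u' & <- & hu)] [hv|(v' & <- & hv)].
    + left. auto.
    + right. exists (u ** v'). split; [|auto].
      now rewrite !gmulA, (bool_seq_commutative w u).
    + right. exists (u' ** v). split; [|auto]. apply gmulA.
    (* [w] is its own inverse by computation, so its two copies cancel. *)
    + left. replace (w ** u' ** (w ** v')) with (u' ** v'); [auto|].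
      rewrite (bool_seq_commutative w u'), <- gmulA. f_equal. symmetry.
      exact (mulKg bool_seq_group w v').
Qed.

Lemma subset_sums_in (l : list bool_seq_group) (u : bool_seq_group) :
  In u l -> In u (subset_sums l).
Proof.
  induction l as [|w l IH]; cbn [subset_sums In]; [easy|].
  rewrite in_app_iff, in_map_iff. intros [<-|hu]; [right|auto].
  exists (gone _). split; [apply gmul1r|apply subset_sums_one].
Qed.

Lemma subset_sums_gen (G : Group) (f : G -> bool_seq_group) (s : list G) :
  is_hom G bool_seq_group f -> generated_by G s ->
  forall x, In (f x) (subset_sums (map f s)).
Proof.
  intros hf hs x. specialize (hs x).
  induction hs as [x hx| |x y _ IHx _ IHy|x _ IHx].
  - apply subset_sums_in, in_map, hx.
  - rewrite hom1 by easy. apply subset_sums_one.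
  - rewrite hf. now apply subset_sums_mul.
  - now rewrite homV.
Qed.

Fixpoint bool_lists (n : nat) : list (list bool) :=
  match n with
  | 0 => [[]]
  | S n => map (cons true) (bool_lists n) ++ map (cons false) (bool_lists n)
  end.

Lemma bool_lists_length (n : nat) : length (bool_lists n) = 2 ^ n.
Proof.
  induction n as [|n IH]; cbn; [reflexivity|]. rewrite length_app, !length_map, IH. lia.
Qed.

Lemma bool_lists_NoDup (n : nat) : NoDup (bool_lists n).
Proof.
  induction n as [|n IH]; cbn; [repeat constructor; auto|].
  apply NoDup_app.
  - apply FinFun.Injective_map_NoDup; [|easy]. intros u v e. now injection e.
  - apply FinFun.Injective_map_NoDup; [|easy]. intros u v e. now injection e.
  - intros u hu hv. apply in_map_iff in hu, hv.
    destruct hu as (u' & <- & _), hv as (v' & e & _). discriminate e.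
Qed.

Lemma in_bool_lists_length (n : nat) (l : list bool) : In l (bool_lists n) -> length l = n.
Proof.
  revert l. induction n as [|n IH]; cbn; intros l.
  - now intros [<-|[]].
  - rewrite in_app_iff, !in_map_iff. intros [(u & <- & hu)|(u & <- & hu)]; cbn; auto.
Qed.

(** By counting: the image of [f] lies in a list of [2 ^ length s] subset sums, and its truncations
    to [n] coordinates include all [2 ^ n] Boolean lists. *)
Lemma generated_by_length (G : Group) (f : G -> bool_seq_group) (n : nat) (s : list G) :
  is_hom G bool_seq_group f ->
  (forall j, j < n -> exists x, f x = Nat.eqb j) ->
  generated_by G s -> n <= length s.
Proof.
  intros hf hn hs.
  assert (hv : forall (v : nat -> bool) k, k <= n -> exists x, forall j, f x j = (j <? k) && v j).
  { intros v k. induction k as [|k IH]; intros hk.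
    - exists (gone G). intros j. now rewrite hom1.
    - destruct IH as [x hx]; [lia|]. destruct (hn k hk) as [y hy].
      exists (if v k then x ** y else x). intros j.
      destruct (Nat.lt_trichotomy j k) as [lt|[->|gt]].
      + transitivity (f x j).
        * destruct (v k); [|easy]. rewrite hf, hy. cbn.
          rewrite (proj2 (Nat.eqb_neq k j)) by lia. apply xorb_false_r.
        * rewrite hx. now rewrite !(proj2 (Nat.ltb_lt _ _)) by lia.
      + rewrite (proj2 (Nat.ltb_lt k (S k))) by lia.
        assert (e := hx k). rewrite Nat.ltb_irrefl in e. cbn in e |- *.
        destruct (v k); [|easy]. rewrite hf, hy. cbn. now rewrite e, Nat.eqb_refl.
      + rewrite (proj2 (Nat.ltb_ge j (S k))) by lia.
        assert (e := hx j). rewrite (proj2 (Nat.ltb_ge j k)) in e by lia. cbn in e |- *.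
        destruct (v k); [|easy]. rewrite hf, hy. cbn.
        now rewrite e, (proj2 (Nat.eqb_neq k j)) by lia. }
  apply (Nat.pow_le_mono_r_iff 2); [lia|].
  rewrite <- (bool_lists_length n), <- (length_map f s), <- subset_sums_length.
  rewrite <- (length_map (fun u : bool_seq_group => map u (seq 0 n)) (subset_sums _)).
  apply NoDup_incl_length; [apply bool_lists_NoDup|].
  intros l hl. apply in_bool_lists_length in hl.
  destruct (hv (fun j => nth j l false) n (le_n n)) as [x hx].
  apply in_map_iff. exists (f x). split; [|now apply subset_sums_gen].
  apply (nth_ext _ _ false false).
  - now rewrite length_map, length_seq.
  - intros j hj. rewrite length_map, length_seq in hj.
    (* [map_nth] requires the default to be an image under the mapped function. *)
    rewrite (nth_indep _ false (f x 0)) by (now rewrite length_map, length_seq).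
    rewrite map_nth, seq_nth by easy. cbn. rewrite hx.
    now rewrite (proj2 (Nat.ltb_lt j n)).
Qed.

Lemma generated_by_list (G : Group) (a b : nat -> G) (g : nat) :
  (forall x, gen G (fun y => exists i, i < g /\ (y = a i \/ y = b i)) x) ->
  generated_by G (map a (seq 0 g) ++ map b (seq 0 g)).
Proof.
  intros hG x. apply (gen_mono G) with (2 := hG x).
  intros y (i & hi & [-> | ->]); apply in_or_app; [left|right];
    apply in_map, in_seq; lia.
Qed.

Lemma twisted_rank (g : nat) (G : Group) (a b : nat -> G) :
  2 <= g ->
  (forall x, gen G (fun y => exists i, i < g /\ (y = a i \/ y = b i)) x) ->
  (forall (H : Group) (c d : nat -> H), residually_nilpotent H -> twisted_relation g H c d ->
     exists f, is_hom G H f /\ forall i, i < g -> f (a i) = c i /\ f (b i) = d i) ->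
  has_rank G (2 * g).
Proof.
  intros hg hG hU. split.
  - exists (map a (seq 0 g) ++ map b (seq 0 g)). split; [|now apply generated_by_list].
    rewrite length_app, !length_map, length_seq. lia.
  (* The [2 * g] generators go to distinct basis vectors; the relation holds because the target is
     commutative. *)
  - intros s. destruct (hU bool_seq_group Nat.eqb (fun i => Nat.eqb (g + i))) as (f & hf & E).
    + apply commutative_residually_nilpotent, bool_seq_commutative.
    + apply prod_comm_commutative, bool_seq_commutative.
    + apply (generated_by_length G f); [easy|]. intros j hj.
      destruct (Nat.lt_ge_cases j g) as [lt|ge].
      * exists (a j). now apply E.
      * exists (b (j - g)). rewrite (proj2 (E (j - g) ltac:(lia))).
        now replace (g + (j - g)) with j by lia.
Qed.

(** * The infinite dihedral group and its action on three points *)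

(** This type is both the field of coefficients and the set of three points acted on. *)
Inductive F3 : Set := f0 | f1 | f2.

Definition F3_add (x y : F3) : F3 :=
  match x, y with
  | f0, z | z, f0 => z
  | f1, f1 => f2
  | f2, f2 => f1
  | _, _ => f0
  end.

Definition F3_opp (x : F3) : F3 := match x with f0 => f0 | f1 => f2 | f2 => f1 end.

Definition F3_mul (x y : F3) : F3 :=
  match x, y with
  | f0, _ | _, f0 => f0
  | f1, z | z, f1 => z
  | f2, f2 => f1
  end.

Definition F3_sub (x y : F3) : F3 := F3_add x (F3_opp y).

Lemma F3_ring_theory : ring_theory f0 f1 F3_add F3_mul F3_sub F3_opp eq.
Proof. constructor; repeat intros []; reflexivity. Qed.
Add Ring F3_ring : F3_ring_theory.

Declare Scope F3_scope.
Delimit Scope F3_scope with F3.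
Bind Scope F3_scope with F3.
Infix "+" := F3_add : F3_scope.
Infix "*" := F3_mul : F3_scope.
Infix "-" := F3_sub : F3_scope.
Notation "- x" := (F3_opp x) : F3_scope.

Definition F3_group : Group.
Proof.
  refine {| carrier := F3; gmul := F3_add; gone := f0; ginv := F3_opp |}; intros; ring.
Defined.

Lemma F3_residually_nilpotent : residually_nilpotent F3_group.
Proof. apply commutative_residually_nilpotent. intros x y. cbn. ring. Qed.

Definition F3_of_Z (n : Z) : F3 :=
  match (n mod 3)%Z with
  | 0%Z => f0
  | 1%Z => f1
  | _ => f2
  end.

Lemma F3_of_Z_cases (n : Z) :
  exists k : Z, ((n = 3 * k /\ F3_of_Z n = f0) \/ (n = 3 * k + 1 /\ F3_of_Z n = f1) \/
                 (n = 3 * k + 2 /\ F3_of_Z n = f2))%Z.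
Proof.
  exists (n / 3)%Z. unfold F3_of_Z. assert (h := Z.div_mod n 3 ltac:(lia)).
  assert (b := Z.mod_pos_bound n 3 ltac:(lia)).
  assert (c : (n mod 3 = 0 \/ n mod 3 = 1 \/ n mod 3 = 2)%Z) by lia.
  destruct c as [c|[c|c]]; rewrite c in *; intuition lia.
Qed.

Lemma F3_of_Z_add (m n : Z) : F3_of_Z (m + n) = (F3_of_Z m + F3_of_Z n)%F3.
Proof.
  destruct (F3_of_Z_cases m) as [k [[em ->]|[[em ->]|[em ->]]]],
    (F3_of_Z_cases n) as [l [[en ->]|[[en ->]|[en ->]]]],
    (F3_of_Z_cases (m + n)) as [p [[ep ->]|[[ep ->]|[ep ->]]]];
    reflexivity || (exfalso; lia).
Qed.

Lemma F3_of_Z_opp (n : Z) : F3_of_Z (- n) = (- F3_of_Z n)%F3.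
Proof.
  assert (h := F3_of_Z_add (- n) n). rewrite Z.add_opp_diag_l in h.
  transitivity (F3_of_Z (- n) + F3_of_Z n - F3_of_Z n)%F3; [ring|].
  rewrite <- h. cbn. ring.
Qed.

(** [(n, e)] is the isometry [k |-> n + k], or [k |-> n - k] if [e], of the integers. *)
Definition dihedral : Group.
Proof.
  refine {| carrier := (Z * bool)%type;
            gmul := fun x y => ((fst x + if snd x then - fst y else fst y)%Z,
                                xorb (snd x) (snd y));
            gone := (0%Z, false);
            ginv := fun x => ((if snd x then fst x else - fst x)%Z, snd x) |};
    repeat intros [? []]; cbn; f_equal; lia.
Defined.

(** All commutators are even translations; a further commutator with a reflection doubles a
    translation, and one with a translation kills it. *)
Lemma dihedral_gamma (i : nat) (x : dihedral) :
  gamma dihedral (S (S i)) x -> snd x = false /\ (2 ^ Z.of_nat (S i) | fst x)%Z.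
Proof.
  revert x. induction i as [|i IH]; intros x.
  all: rewrite gammaS by lia;
    induction 1 as [z (x & y & hy & ->)| |x y _ [ex hx] _ [ey hy]|x _ [ex hx]].
  all: try (split; [reflexivity|apply Z.divide_0_r]).
  all: try (cbn [gmul ginv dihedral fst snd]; rewrite ex; try rewrite ey; split; [reflexivity|];
    first [now apply Z.divide_add_r | now apply Z.divide_opp_r]).
  - destruct x as [m e], y as [n f]. split; [now destruct e, f|].
    (* Half the translation part of the commutator in each of the four cases. *)
    exists (if e then if f then m - n else n else if f then - m else 0)%Z.
    destruct e, f; cbn [comm gmul ginv dihedral fst snd xorb Nat.add]; lia.
  - apply IH in hy. destruct hy as [ey hy]. rewrite Nat2Z.inj_succ, Z.pow_succ_r by lia.
    destruct x as [m e], y as [n f]. cbn [fst snd] in ey, hy. subst f.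
    split; [now destruct e|]. destruct hy as [k ->].
    exists (if e then k else 0)%Z. destruct e; cbn [comm gmul ginv dihedral fst snd xorb]; ring.
Qed.

Lemma dihedral_residually_nilpotent : residually_nilpotent dihedral.
Proof.
  intros [n e] h.
  (* The resulting divisor [2 ^ (|n| + 1)] of [n] exceeds [|n|], which forces [n = 0]. *)
  destruct (dihedral_gamma (Z.to_nat (Z.abs n)) (n, e)) as [E D]; [apply h; lia|].
  cbn [fst snd] in E, D. subst e. f_equal.
  destruct (Z.eq_dec n 0) as [->|nz]; [reflexivity|exfalso].
  apply Z.divide_abs_r, Z.divide_pos_le in D; [|lia].
  assert (lt := Z.pow_gt_lin_r 2 (Z.of_nat (S (Z.to_nat (Z.abs n))))). lia.
Qed.

Definition dihedral_act (x : dihedral) (p : F3) : F3 :=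
  (F3_of_Z (fst x) + if snd x then - p else p)%F3.

Lemma dihedral_act_one (p : F3) : dihedral_act (gone dihedral) p = p.
Proof. now destruct p. Qed.

Lemma dihedral_act_mul (x y : dihedral) (p : F3) :
  dihedral_act (x ** y) p = dihedral_act x (dihedral_act y p).
Proof.
  destruct x as [m []], y as [n []]; unfold dihedral_act; cbn [gmul dihedral fst snd xorb];
    rewrite F3_of_Z_add, ?F3_of_Z_opp; ring.
Qed.

(** * Cup products on a subgroup of index three *)

Section Extension.
Context (G : Group) (al be : G -> F3) (act : G -> F3 -> F3).
Context (al_hom : is_hom G F3_group al) (be_hom : is_hom G F3_group be).
Context (act_one : forall p, act (gone G) p = p).
Context (act_mul : forall x y p, act (x ** y) p = act x (act y p)).

Definition fn_act (x : G) (m : F3 -> F3) : F3 -> F3 := fun p => m (act x^-1 p).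
Definition fn_add (m n : F3 -> F3) : F3 -> F3 := fun p => (m p + n p)%F3.
Definition fn_opp (m : F3 -> F3) : F3 -> F3 := fun p => (- m p)%F3.
Definition fn_sub (m n : F3 -> F3) : F3 -> F3 := fun p => (m p - n p)%F3.
Definition fn_const (c : F3) : F3 -> F3 := fun _ => c.

Lemma al_mul (x y : G) : al (x ** y) = (al x + al y)%F3.
Proof. apply al_hom. Qed.

Lemma be_mul (x y : G) : be (x ** y) = (be x + be y)%F3.
Proof. apply be_hom. Qed.

Lemma al_inv (x : G) : al x^-1 = (- al x)%F3.
Proof. apply (homV G F3_group al al_hom). Qed.

Lemma be_inv (x : G) : be x^-1 = (- be x)%F3.
Proof. apply (homV G F3_group be be_hom). Qed.

Lemma al_one : al (gone G) = f0.
Proof. apply (hom1 G F3_group al al_hom). Qed.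

Lemma be_one : be (gone G) = f0.
Proof. apply (hom1 G F3_group be be_hom). Qed.

Lemma act_inv (x : G) (p : F3) : act x^-1 (act x p) = p.
Proof. now rewrite <- act_mul, gmulVl. Qed.

Lemma act_invr (x : G) (p : F3) : act x (act x^-1 p) = p.
Proof. now rewrite <- act_mul, gmulVr. Qed.

(** The extension of [G] by the permutation module of functions on three points
    whose cocycle is the cup product of [al] and [be], with constant values. *)
Definition extension : Group.
Proof.
  refine {| carrier := ((F3 -> F3) * G)%type;
            gmul := fun x y => (fun p => (fst x p + fst y (act (snd x)^-1 p)
                                          + al (snd x) * be (snd y))%F3, snd x ** snd y);
            gone := (fn_const f0, gone G);
            ginv := fun x => (fun p => (- fst x (act (snd x) p) + al (snd x) * be (snd x))%F3,
                              (snd x)^-1) |}.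
  - intros [m x] [n y] [k z]; cbn. f_equal; [|apply gmulA].
    apply functional_extensionality; intros p.
    rewrite invMg, act_mul, al_mul, be_mul. ring.
  - intros [m x]; cbn. f_equal; [|apply gmul1l].
    apply functional_extensionality; intros p. rewrite inv1g, act_one, al_one.
    unfold fn_const. ring.
  - intros [m x]; cbn. f_equal; [|apply gmul1r].
    apply functional_extensionality; intros p. rewrite be_one. unfold fn_const. ring.
  - intros [m x]; cbn. f_equal; [|apply gmulVl].
    apply functional_extensionality; intros p. rewrite invgK, al_inv. unfold fn_const. ring.
  - intros [m x]; cbn. f_equal; [|apply gmulVr].
    apply functional_extensionality; intros p. rewrite act_invr, be_inv. unfold fn_const. ring.
Defined.

Definition incl (m : F3 -> F3) : extension := (m, gone G).
(** A section of the projection as a map of sets; its failure to be multiplicative is the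
    cocycle. *)
Definition lift (x : G) : extension := (fn_const f0, x).

Ltac fn_ring :=
  apply functional_extensionality; intros ?;
  unfold fn_add, fn_sub, fn_opp, fn_act, fn_const;
  repeat first [rewrite invMg | rewrite invgK | rewrite inv1g | rewrite act_mul
    | rewrite act_one | rewrite act_inv | rewrite act_invr]; try ring.

Lemma extension_eq (m n : F3 -> F3) (x y : G) : m = n -> x = y -> (m, x) = (n, y) :> extension.
Proof. now intros -> ->. Qed.

Lemma incl_mul (m n : F3 -> F3) : incl m ** incl n = incl (fn_add m n).
Proof.
  apply extension_eq; cbn; [|apply gmul1l]. rewrite al_one. fn_ring.
Qed.

Lemma incl_lift (m : F3 -> F3) (x : G) : incl m ** lift x = (m, x).
Proof.
  apply extension_eq; cbn; [|apply gmul1l]. rewrite al_one. fn_ring.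
Qed.

Lemma incl_inv (m : F3 -> F3) : (incl m)^-1 = incl (fn_opp m).
Proof.
  apply extension_eq; cbn; [|apply inv1g]. rewrite al_one. fn_ring.
Qed.

Lemma incl_conj (z : extension) (m : F3 -> F3) :
  z ** incl m = incl (fn_act (snd z) m) ** z.
Proof.
  destruct z as [n x]. apply extension_eq; cbn; [|now rewrite gmul1l, gmul1r].
  rewrite al_one, be_one. fn_ring.
Qed.

(** The operators on [u] and [v] are the Fox derivatives of the commutator, [x^-1 (y^-1 - 1)] and
    [x^-1 y^-1 (x - 1)]. *)
Lemma comm_incl_mul (x y : extension) (u v : F3 -> F3) :
  [~ incl u ** x, incl v ** y] =
  incl (fn_act (snd x)^-1 (fn_sub (fn_act (snd y)^-1 (fn_add (fn_sub u v) (fn_act (snd x) v))) u))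
  ** [~ x, y].
Proof.
  transitivity (x^-1 ** ((incl u)^-1 ** (y^-1 ** ((incl v)^-1 ** incl u ** (x ** incl v))) ** y)).
  { group. }
  rewrite !incl_inv, incl_mul, (incl_conj x), (gmulA _ (incl _) (incl _) x), incl_mul.
  rewrite (gmulA _ y^-1 (incl _) x), (incl_conj y^-1), <- (gmulA _ (incl _) y^-1 x).
  rewrite (gmulA _ (incl _) (incl _)), incl_mul, !gmulA, (incl_conj x^-1).
  unfold comm. rewrite !gmulA. do 5 f_equal. cbn [ginv extension snd]. fn_ring.
Qed.

(** When the generators below [k] generate [G], this is the augmentation ideal times the module. The
    bound [k] follows the partial products of the relator. *)
Inductive moved (a b : nat -> G) (k : nat) : (F3 -> F3) -> Prop :=
  | moved_zero : moved a b k (fn_const f0)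
  | moved_a i m : i < k -> moved a b k (fn_sub (fn_act (a i) m) m)
  | moved_b i m : i < k -> moved a b k (fn_sub (fn_act (b i) m) m)
  | moved_add m n : moved a b k m -> moved a b k n -> moved a b k (fn_add m n).

Lemma moved_opp (a b : nat -> G) (k : nat) (m : F3 -> F3) :
  moved a b k m -> moved a b k (fn_opp m).
Proof.
  induction 1 as [|i m hi|i m hi|m n _ IHm _ IHn].
  - replace (fn_opp _) with (fn_const f0) by fn_ring. apply moved_zero.
  - replace (fn_opp _) with (fn_sub (fn_act (a i) (fn_opp m)) (fn_opp m)) by fn_ring.
    now apply moved_a.
  - replace (fn_opp _) with (fn_sub (fn_act (b i) (fn_opp m)) (fn_opp m)) by fn_ring.
    now apply moved_b.
  - replace (fn_opp _) with (fn_add (fn_opp m) (fn_opp n)) by fn_ring.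
    now apply moved_add.
Qed.

(** In the group ring, [x y - 1 = (x - 1) y + (y - 1)] and [x^-1 - 1 = - (x - 1) x^-1]. *)
Lemma moved_gen (a b : nat -> G) (k : nat) (x : G) :
  gen G (fun y => exists i, i < k /\ (y = a i \/ y = b i)) x ->
  forall m, moved a b k (fn_sub (fn_act x m) m).
Proof.
  induction 1 as [x (i & hi & [-> | ->])| |x y _ IHx _ IHy|x _ IHx]; intros m.
  - now apply moved_a.
  - now apply moved_b.
  - replace (fn_sub _ _) with (fn_const f0) by fn_ring. apply moved_zero.
  - replace (fn_sub _ _) with (fn_add (fn_sub (fn_act x (fn_act y m)) (fn_act y m))
      (fn_sub (fn_act y m) m)) by fn_ring. now apply moved_add.
  - replace (fn_sub _ _) with (fn_opp (fn_sub (fn_act x (fn_act x^-1 m)) (fn_act x^-1 m)))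
      by fn_ring. now apply moved_opp.
Qed.

(** As [(x - 1) m] is additive in [m], all contributions of the last pair merge into one [u] and one
    [v]. *)
Lemma moved_last (a b : nat -> G) (k : nat) (m : F3 -> F3) :
  moved a b (S k) m -> exists n u v, moved a b k n /\
    m = fn_add n (fn_add (fn_sub (fn_act (a k) u) u) (fn_sub (fn_act (b k) v) v)).
Proof.
  set (z := fn_const f0).
  assert (z0 : forall x, fn_sub (fn_act x z) z = z) by (intros x; unfold z; fn_ring).
  induction 1 as [|i m hi|i m hi|m n _ (m' & u & v & hm & em) _ (n' & u' & v' & hn & en)].
  - exists z, z, z. split; [apply moved_zero|]. rewrite !z0. unfold z. fn_ring.
  - destruct (Nat.eq_dec i k) as [->|ne].
    + exists z, m, z. split; [apply moved_zero|]. rewrite !z0. unfold z. fn_ring.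
    + eexists _, z, z. split; [apply (moved_a a b k i m); lia|]. rewrite !z0.
      unfold z. fn_ring.
  - destruct (Nat.eq_dec i k) as [->|ne].
    + exists z, z, m. split; [apply moved_zero|]. rewrite !z0. unfold z. fn_ring.
    + eexists _, z, z. split; [apply (moved_b a b k i m); lia|]. rewrite !z0.
      unfold z. fn_ring.
  - exists (fn_add m' n'), (fn_add u u'), (fn_add v v'). split; [now apply moved_add|].
    rewrite em, en. fn_ring.
Qed.

Lemma gen_prod_comm (a b : nat -> G) (k : nat) :
  gen G (fun y => exists i, i < k /\ (y = a i \/ y = b i)) (prod_comm G a b k).
Proof.
  induction k as [|k IH]; cbn; [apply gen_one|]. apply gen_mul.
  - revert IH. apply gen_mono. intros y (i & hi & E). exists i. split; [lia|easy].
  - assert (ha : gen G (fun y => exists i, i < S k /\ (y = a i \/ y = b i)) (a k)).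
    { apply gen_base. exists k. auto. }
    assert (hb : gen G (fun y => exists i, i < S k /\ (y = a i \/ y = b i)) (b k)).
    { apply gen_base. exists k. auto. }
    unfold comm. repeat first [assumption | apply gen_mul | apply gen_inv].
Qed.

Lemma snd_hom : is_hom extension G snd.
Proof. easy. Qed.

(** Changing the lifts of the generators changes the value of the relator by the
    image of the Fox derivatives, which is all of [moved]. *)
Lemma prod_comm_moved (a b : nat -> G) (k : nat) (w : F3 -> F3) :
  moved a b k w -> exists U V : nat -> F3 -> F3,
    prod_comm extension (fun i => (U i, a i)) (fun i => (V i, b i)) k =
    incl w ** prod_comm extension (fun i => lift (a i)) (fun i => lift (b i)) k.
Proof.
  revert w. induction k as [|k IH]; intros w hw.
  - exists (fun _ => fn_const f0), (fun _ => fn_const f0). cbn [prod_comm].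
    rewrite gmul1r. unfold incl. apply extension_eq; [|reflexivity].
    symmetry. induction hw as [|i m hi|i m hi|m n _ -> _ ->]; try lia; [reflexivity|fn_ring].
  - destruct (moved_last _ _ _ _ hw) as (n & u & v & hn & ->).
    set (t := fn_add (fn_sub (fn_act (a k) u) u) (fn_sub (fn_act (b k) v) v)).
    set (P := prod_comm extension (fun i => lift (a i)) (fun i => lift (b i)) k).
    (* These choices make the Fox derivatives of the last commutator give exactly [t]:
       [u' + (a k - 1) v' = - (b k) v] and [v' - u = t]. *)
    set (v' := fn_add (fn_act (a k) u) (fn_sub (fn_act (b k) v) v)).
    set (u' := fn_sub (fn_opp (fn_act (b k) v)) (fn_sub (fn_act (a k) v') v')).
    assert (sP : snd P = prod_comm G a b k).
    { unfold P. now rewrite (hom_prod_comm _ _ _ _ _ _ snd_hom). }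
    (* Moving [t] left past [P] turns it into [P t]; subtracting [P t - t] beforehand
       compensates. *)
    destruct (IH (fn_add n (fn_opp (fn_sub (fn_act (snd P) t) t)))) as (U & V & E).
    { apply moved_add; [easy|]. apply moved_opp, moved_gen. rewrite sP. apply gen_prod_comm. }
    exists (fun i => if i =? k then u' else U i), (fun i => if i =? k then v' else V i).
    cbn [prod_comm]. rewrite Nat.eqb_refl.
    rewrite (prod_comm_ext extension _ _ (fun i => (U i, a i)) (fun i => (V i, b i))).
    2: { intros i hi. now rewrite (proj2 (Nat.eqb_neq i k)) by lia. }
    rewrite E, <- !incl_lift, comm_incl_mul. fold P.
    replace (fn_act (snd (lift (a k)))^-1 _) with t.
    2: { cbn [lift snd]. unfold t, u', v'. fn_ring. }
    rewrite <- (gmulA _ _ P), (gmulA _ P), (incl_conj P), !gmulA, incl_mul.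
    do 3 f_equal. fn_ring.
Qed.

(** The cocycle has constant values and the action fixes constants, so the elements with constant
    module part form a subgroup containing the lifts. *)
Lemma prod_comm_lift_const (a b : nat -> G) (k : nat) :
  exists c, fst (prod_comm extension (fun i => lift (a i)) (fun i => lift (b i)) k) = fn_const c.
Proof.
  assert (M : forall x y : extension, (exists c, fst x = fn_const c) ->
    (exists c, fst y = fn_const c) -> exists c, fst (x ** y) = fn_const c).
  { intros x y [c hc] [d hd]. exists (c + d + al (snd x) * be (snd y))%F3. cbn.
    now rewrite hc, hd. }
  assert (V : forall x : extension, (exists c, fst x = fn_const c) ->
    exists c, fst x^-1 = fn_const c).
  { intros x [c hc]. exists (- c + al (snd x) * be (snd x))%F3. cbn. now rewrite hc. }
  assert (L : forall x, exists c, fst (lift x) = fn_const c).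
  { intros x. now exists f0. }
  induction k as [|k IH]; [now exists f0|]. cbn [prod_comm]. unfold comm. auto 10.
Qed.

(** With [m] supported at [f0], the sum [(x1 m - m) + (x2 m - m)] has values [-2 c], [c], [c], and
    [-2 = 1] modulo 3. *)
Lemma moved_const (g : nat) (a b : nat -> G) (c : F3) :
  (forall x, gen G (fun y => exists i, i < g /\ (y = a i \/ y = b i)) x) ->
  (forall p, exists x, act x f0 = p) -> moved a b g (fn_const c).
Proof.
  intros hG trans. destruct (trans f1) as [x1 h1], (trans f2) as [x2 h2].
  set (m := fun p => match p with f0 => c | _ => f0 end).
  replace (fn_const c) with
    (fn_add (fn_sub (fn_act x1 m) m) (fn_sub (fn_act x2 m) m)).
  { apply moved_add; now apply moved_gen. }
  assert (E : forall x p q, act x f0 = p -> fn_act x m q =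
    match q, p with f0, f0 | f1, f1 | f2, f2 => c | _, _ => f0 end).
  { intros x p q hp. unfold fn_act. assert (hq := act_invr x q).
    assert (inj : forall r, act x r = p -> r = f0).
    { intros r hr. now rewrite <- (act_inv x r), hr, <- hp, act_inv. }
    destruct (act x^-1 q); cbn [m].
    - rewrite hp in hq. subst q. now destruct p.
    - destruct q, p; try reflexivity; discriminate (inj f1 hq).
    - destruct q, p; try reflexivity; discriminate (inj f2 hq). }
  apply functional_extensionality. intros q. unfold fn_add, fn_sub, fn_const.
  rewrite (E x1 f1 q h1), (E x2 f2 q h2). destruct q, c; reflexivity.
Qed.

(** The cup product of [al] and [be] evaluated on the surface relator: one determinant per
    handle. *)
Fixpoint cup (a b : nat -> G) (k : nat) : F3 :=
  match k with
  | 0 => f0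
  | S k => (cup a b k + (al (a k) * be (b k) - be (a k) * al (b k)))%F3
  end.

(** The relator of the extension can be made trivial because constants lie in
    [moved]: their sum over the three points is zero. So the extension splits, and
    evaluating the section at a point trivialises the cocycle on its stabiliser. *)
Lemma surface_cup (g : nat) (a b c d : nat -> G) :
  is_surface_group g G a b -> (forall p, exists x, act x f0 = p) ->
  prod_comm G c d g = gone G ->
  (forall i, i < g -> act (c i) f0 = f0 /\ act (d i) f0 = f0) -> cup c d g = f0.
Proof.
  intros (rG & hG & uG) trans rcd fix0.
  destruct (prod_comm_lift_const a b g) as [l hl].
  (* The correction [- l] cancels the constant [l] by which the relator fails on the lifts. *)
  destruct (prod_comm_moved a b g (fn_const (- l)%F3)) as (U & V & E).
  { now apply moved_const. }
  destruct (uG extension (fun i => (U i, a i)) (fun i => (V i, b i))) as (s & hs & Es).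
  { rewrite E. apply injective_projections.
    - cbn [gmul gone extension fst snd incl]. rewrite hl, al_one. fn_ring.
    - rewrite snd_hom, (hom_prod_comm _ _ _ _ _ _ snd_hom).
      transitivity (gone G ** prod_comm G a b g); [reflexivity|]. now rewrite rG, gmul1l. }
  assert (ss : forall x, snd (s x) = x).
  { intros x. apply (hom_gen_eq G G _ (fun x => snd (s x)) (fun x => x)) with (4 := hG x).
    - now apply (hom_comp G extension G).
    - easy.
    - intros y (i & hi & [-> | ->]); destruct (Es i hi) as [e1 e2].
      + now rewrite e1.
      + now rewrite e2. }
  (* Elements of the stabiliser do not move the evaluation point, so there the coboundary of [t] is,
     up to sign, the cocycle. *)
  set (t := fun x => fst (s x) f0). set (fixes := fun x => act x f0 = f0).
  assert (fM : forall x y, fixes x -> fixes y -> fixes (x ** y)).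
  { unfold fixes. intros x y hx hy. now rewrite act_mul, hy. }
  assert (fV : forall x, fixes x -> fixes x^-1).
  { unfold fixes. intros x hx. rewrite <- hx at 1. apply act_inv. }
  assert (tM : forall x y, fixes x -> t (x ** y) = (t x + t y + al x * be y)%F3).
  { intros x y hx. apply fV in hx. unfold t. rewrite hs. cbn. rewrite !ss.
    now rewrite hx. }
  assert (t1 : t (gone G) = f0) by (unfold t; now rewrite hom1).
  assert (tV : forall x, fixes x -> t x^-1 = (- t x + al x * be x)%F3).
  { intros x hx. assert (e := tM _ x (fV x hx)). rewrite gmulVl, t1, al_inv in e.
    transitivity (t x^-1 + t x + - al x * be x + (- t x + al x * be x))%F3; [ring|].
    rewrite <- e. ring. }
  (* On a commutator in the stabiliser the values of [t] cancel and leave the determinant; [al]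
     vanishes on partial products, so the determinants add up. *)
  assert (main : forall k, k <= g -> fixes (prod_comm G c d k) /\ al (prod_comm G c d k) = f0
    /\ t (prod_comm G c d k) = cup c d k).
  { induction k as [|k IH]; intros hk; cbn [prod_comm cup].
    - split; [apply act_one|split; [apply al_one|exact t1]].
    - destruct IH as (hf & ha & ht); [lia|]. destruct (fix0 k) as [fc fd]; [lia|].
      split; [|split].
      + unfold comm. auto 10.
      + unfold comm. rewrite !al_mul, !al_inv, ha. ring.
      + rewrite tM, ha, ht by easy. unfold comm.
        rewrite !tM, !tV, !al_mul, !be_mul, !al_inv, !be_inv by auto. ring. }
  rewrite <- (proj2 (proj2 (main g (le_n g)))). now rewrite rcd.
Qed.
End Extension.

(** * The twisted group is not a surface group *)

Lemma surface_group_isomorphic (g : nat) (G Gam : Group) (a b : nat -> Gam) :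
  isomorphic G Gam -> is_surface_group g Gam a b ->
  exists a' b' : nat -> G, is_surface_group g G a' b'.
Proof.
  intros (h & hh & inj & sur) (rGam & genGam & uGam).
  destruct (surjective_section _ _ h sur) as [k hk].
  assert (kh : is_hom Gam G k) by (intros x y; apply inj; now rewrite hh, !hk).
  exists (fun i => k (a i)), (fun i => k (b i)). split; [|split].
  - rewrite <- (hom_prod_comm _ _ _ _ _ _ kh), rGam. now apply hom1.
  - intros x. replace x with (k (h x)) by (apply inj; now rewrite hk).
    apply (gen_image Gam G k) with (3 := genGam (h x)); [easy|].
    intros y (i & hi & E). apply gen_base. exists i. split; [easy|].
    destruct E as [-> | ->]; auto.
  - intros H c d hr. destruct (uGam H c d hr) as (f & hf & E).
    exists (fun x => f (h x)). split; [now apply (hom_comp G Gam H)|].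
    intros i hi. rewrite !hk. auto.
Qed.

Lemma twisted_not_surface_group (g : nat) (G : Group) (a b a' b' : nat -> G) :
  2 <= g -> twisted_relation g G a b ->
  (forall (H : Group) (c d : nat -> H), residually_nilpotent H -> twisted_relation g H c d ->
     exists f, is_hom G H f /\ forall i, i < g -> f (a i) = c i /\ f (b i) = d i) ->
  ~ is_surface_group g G a' b'.
Proof.
  intros hg rG uG hS.
  (* Used for [al] and [be], the classes dual to [a 0] and [b 0]. *)
  set (e0 := fun i => match i with 0 => f1 | S _ => f0 end).
  destruct (uG F3_group e0 (fun _ => f0)) as (al & al_hom & Eal).
  { apply F3_residually_nilpotent. }
  { apply prod_comm_commutative. intros x y. cbn. ring. }
  destruct (uG F3_group (fun _ => f0) e0) as (be & be_hom & Ebe).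
  { apply F3_residually_nilpotent. }
  { apply prod_comm_commutative. intros x y. cbn. ring. }
  (* [[~ r 1, r 0]] is the translation by 2, so [r 0] twists to the translation by 3, which acts
     trivially modulo 3, while [r 0] itself permutes the three points cyclically. *)
  set (r := fun i => match i with 0 => (1%Z, false) | 1 => (0%Z, true) | _ => gone dihedral end
    : dihedral).
  destruct (uG dihedral r (fun _ => gone dihedral)) as (rho & rho_hom & Erho).
  { apply dihedral_residually_nilpotent. }
  { apply prod_comm_one. }
  assert (h0 : 0 < g) by lia.
  assert (tw : forall i, i < g -> al (twist G a i) = e0 i /\ be (twist G a i) = f0 /\
    rho (twist G a i) = twist dihedral r i).
  { intros i hi. rewrite !hom_twist by easy.
    rewrite (twist_ext F3_group g (fun j => al (a j)) e0),
      (twist_ext F3_group g (fun j => be (a j)) (fun _ => f0)),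
      (twist_ext dihedral g (fun j => rho (a j)) r); try easy.
    - now destruct i.
    - intros j hj. now apply Erho.
    - intros j hj. now apply Ebe.
    - intros j hj. now apply Eal. }
  assert (C : forall k, k <= g -> cup G al be (twist G a) b k =
    match k with 0 => f0 | S _ => f1 end).
  { induction k as [|k IH]; intros hk; [reflexivity|]. cbn [cup]. rewrite IH by lia.
    destruct (tw k hk) as (-> & -> & _). rewrite (proj2 (Eal k hk)), (proj2 (Ebe k hk)).
    now destruct k. }
  assert (K : cup G al be (twist G a) b g = f0).
  { apply (surface_cup G al be (fun x => dihedral_act (rho x)) al_hom be_hom) with a' b'; auto.
    - intros p. rewrite hom1 by easy. apply dihedral_act_one.
    - intros x y p. rewrite rho_hom. apply dihedral_act_mul.
    - destruct (Erho 0 h0) as [E _].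
      intros []; [exists (gone G)|exists (a 0)|exists (a 0 ** a 0)].
      + now rewrite hom1.
      + now rewrite E.
      + now rewrite rho_hom, E.
    - intros i hi. destruct (tw i hi) as (_ & _ & ->). rewrite (proj2 (Erho i hi)).
      split; [|reflexivity]. now destruct i as [|[|i]]. }
  rewrite C in K by easy. destruct g; [lia|discriminate].
Qed.

Theorem theorem1 :
  forall (g : nat), 2 <= g ->
  forall (Gam : Group) (a b : nat -> Gam), is_surface_group g Gam a b ->
  exists G : Group,
    residually_nilpotent G /\
    has_rank G (2 * g) /\
    ~ isomorphic G Gam /\
    (forall i : nat, 1 <= i ->
       quotient_isomorphic G (gamma G i) Gam (gamma Gam i)).
Proof.
  intros g hg Gam a b hS.
  destruct (twisted_group g hg) as (G & c & d & hR & hr & hG & hU).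
  exists G. split; [easy|split; [|split]].
  - now apply (twisted_rank g G c d).
  - intros iso. destruct (surface_group_isomorphic g G Gam a b iso hS) as (a' & b' & hS').
    now apply (twisted_not_surface_group g G c d a' b' hg hr hU).
  - now apply (twisted_quotient_isomorphic g Gam a b G c d).
Qed.
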